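(* Let $S^{(1)},S^{(2)}\in\operatorname{Sp}(2n,\mathbb{R})$ with block forms $S^{(p)}=\begin{pmatrix}A^{(p)}&B^{(p)}\\ C^{(p)}&D^{(p)}\end{pmatrix}$, $p=1,2$, let $D^{(1,2)}=\begin{pmatrix}A^{(1)}&B^{(1)}\\ A^{(2)}&B^{(2)}\end{pmatrix}$ with $\det D^{(1,2)}\ne0$, and let $\Omega=D^{(1,2)}J(D^{(1,2)})^T$. Let $f\in L^2(\mathbb{R}^n)$, $\|f\|_2=1$, be such that $\int_{\mathbb{R}^{2n}}(1+|z|^2)|W_\sigma f(z)|\,dz<\infty$ and $\int_{\mathbb{R}^{2n}}z_\alpha W_\sigma f(z)\,dz=0$ for all $\alpha$, and let $\Upsilon$ be the covariance matrix $$\Upsilon_{\alpha\beta}=\sum_{1\le\tau,\lambda\le2n}D^{(1,2)}_{\alpha,\tau}D^{(1,2)}_{\beta,\lambda}\int_{\mathbb{R}^{2n}}z_\tau z_\lambda W_\sigma f(z)\,dz,\qquad \alpha,\beta=1,\dots,2n .$$ Then $\Upsilon$ can be evaluated as an ordinary covariance matrix for the bilinear distribution $W_\vartheta f$: $$\Upsilon_{\alpha\beta}=\int_{\mathbb{R}^{2n}}z_\alpha z_\beta\,W_\vartheta f(z)\,dz .$$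
   Context: $J=\begin{pmatrix}0&I_n\\ -I_n&0\end{pmatrix}$, and $\operatorname{Sp}(2n,\mathbb{R})$ is the group of real $2n\times2n$ matrices $S$ with $S^TJS=J$. The Wigner function of $f\in L^2(\mathbb{R}^n)$ is $$W_\sigma f(x,\xi)=\int_{\mathbb{R}^n}f\left(x+\tfrac y2\right)\overline{f\left(x-\tfrac y2\right)}\,e^{-2i\pi\xi\cdot y}\,dy ,\qquad z=(x,\xi)\in\mathbb{R}^{2n}.$$ The Wigner function on the symplectic vector space $(\mathbb{R}^{2n};\vartheta)$, $\vartheta(z,z')=z\cdot\Omega^{-1}z'$, is $$W_\vartheta f(z)=\frac{1}{\sqrt{\det\Omega}}\,W_\sigma f\left((D^{(1,2)})^{-1}z\right),\qquad \sqrt{\det\Omega}=|\det D^{(1,2)}| .$$ *)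

(* Defs.v *)
From HB Require Import structures.
From mathcomp Require Import all_boot all_order all_algebra.
From mathcomp Require Import all_classical all_reals all_analysis.
From mathcomp Require Import complex.

Set Implicit Arguments.
Unset Strict Implicit.
Unset Printing Implicit Defensive.

Import Order.TTheory GRing.Theory Num.Theory.
Import numFieldNormedType.Exports.

Local Open Scope classical_set_scope.
Local Open Scope ring_scope.
Local Open Scope complex_scope.

(* MathComp-Analysis has no measurable structure on matrices: ['M[R]_(m, n)]
   gets the product (equivalently Borel) sigma-algebra, generated by the
   entries. *)
Fact measure_matrix_display : measure_display.
Proof. exact. Qed.

Section measurable_matrix.
Context {R : realType} {m n : nat}.

Definition matrix_measurable : set (set 'M[R]_(m, n)) :=
  <<s \bigcup_(ij in [set: 'I_m * 'I_n])
        preimage_set_system setT (fun M : 'M[R]_(m, n) => M ij.1 ij.2)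
          (@measurable _ R) >>.

Let matrix_measurable0 : matrix_measurable set0.
Proof. exact: sigma_algebra0. Qed.

Let matrix_measurableC A : matrix_measurable A -> matrix_measurable (~` A).
Proof. exact: sigma_algebraC. Qed.

Let matrix_measurable_bigcup (F : (set 'M[R]_(m, n))^nat) :
  (forall i, matrix_measurable (F i)) -> matrix_measurable (\bigcup_i F i).
Proof. exact: sigma_algebra_bigcup. Qed.

HB.instance Definition _ := @isMeasurable.Build measure_matrix_display
  'M[R]_(m, n) matrix_measurable
  matrix_measurable0 matrix_measurableC matrix_measurable_bigcup.

Lemma measurable_entry (i : 'I_m) (j : 'I_n) :
  measurable_fun [set: 'M[R]_(m, n)]
    (fun M : 'M[R]_(m, n) => M i j).
Proof.
move=> _ Y mY; rewrite setTI; apply: sub_sigma_algebra => /=.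
by exists (i, j) => //; exists Y => //; rewrite setTI.
Qed.

Lemma measurable_fun_matrixP d (T : measurableType d) (f : T -> 'M[R]_(m, n)) :
  measurable_fun setT f <->
  forall i j, measurable_fun setT (fun x => f x i j).
Proof.
split=> [mf i j|mf].
  exact: (measurableT_comp (measurable_entry i j) mf).
move=> _ A mA; rewrite setTI.
suff : matrix_measurable `<=` [set B | measurable (f @^-1` B)] by exact.
apply: smallest_sub.
  split=> /= [|B mB|F mF].
  - by rewrite preimage_set0.
  - by rewrite setTD preimage_setC; exact: measurableC.
  - by rewrite preimage_bigcup; exact: bigcupT_measurable.
move=> B [[i j] _ [Y mY <-]] /=; rewrite setTI.
by have := mf i j measurableT Y mY; rewrite setTI.
Qed.

End measurable_matrix.

Section lebesgue_measure_cons.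
Local Open Scope ereal_scope.
Context {R : realType} {n : nat}.

Definition vcons (p : measurableTypeR R * 'cV[R]_n) : 'cV[R]_n.+1 :=
  col_mx (p.1%:M : 'M[R]_1) p.2.

Definition vsplit (v : 'cV[R]_n.+1) : measurableTypeR R * 'cV[R]_n :=
  (usubmx (v : 'cV[R]_(1 + n)) 0%R 0%R, dsubmx (v : 'cV[R]_(1 + n))).

Lemma vsplitK : cancel vsplit vcons.
Proof.
move=> v; rewrite /vcons /=.
rewrite -[RHS](@vsubmxK _ 1 n 1 v); congr (@col_mx _ 1 n 1 _ _).
by apply/matrixP => i j; rewrite !ord1 !mxE mulr1n.
Qed.

Lemma vconsK : cancel vcons vsplit.
Proof.
by case=> x v; rewrite /vsplit /vcons /= col_mxKu col_mxKd mxE mulr1n.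
Qed.

Lemma vcons0 p : vcons p ord0 ord0 = p.1.
Proof.
rewrite /vcons (_ : ord0 = lshift n (ord0 : 'I_1)) ?(@col_mxEu _ 1 n 1).
  by rewrite mxE; exact: mulr1n.
exact/val_inj.
Qed.

Lemma vconsS p i : vcons p (lift ord0 i) ord0 = p.2 i ord0.
Proof.
rewrite /vcons (_ : lift ord0 i = rshift 1 i) ?(@col_mxEd _ 1 n 1)//.
exact/val_inj.
Qed.

Lemma measurable_vcons : measurable_fun setT vcons.
Proof.
apply/measurable_fun_matrixP => i j; rewrite ord1.
have [k ->|->] := unliftP ord0 i.
- under eq_fun do rewrite vconsS.
  exact: (measurableT_comp (measurable_entry k ord0) measurable_snd).
- under eq_fun do rewrite vcons0.
  exact: measurable_fst.
Qed.

Lemma measurable_vsplit : measurable_fun setT vsplit.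
Proof.
apply: measurable_fun_pair.
- rewrite [X in measurable_fun _ X](_ : _ = fun v : 'cV[R]_n.+1 => v ord0 ord0).
    exact: measurable_entry.
  by apply/funext => v; rewrite mxE; congr (v _ _); exact/val_inj.
- apply/measurable_fun_matrixP => i j.
  rewrite [X in measurable_fun _ X](_ : _ =
    fun v : 'cV[R]_n.+1 => v (rshift 1 i : 'I_n.+1) j).
    exact: measurable_entry.
  by apply/funext => v; rewrite mxE.
Qed.

Variable mu : {sigma_finite_measure set 'cV[R]_n -> \bar R}.

Definition lebesgue_measure_cons : set 'cV[R]_n.+1 -> \bar R :=
  pushforward (@lebesgue_measure R \x mu) vcons.

HB.instance Definition _ := Measure.copy lebesgue_measure_cons
  (measure_function_pushforward__canonical__measure_function_Measure
     (@lebesgue_measure R \x mu) measurable_vcons).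

Let lebesgue_measure_cons_sigma_finite :
  sigma_finite setT lebesgue_measure_cons.
Proof.
have /sigma_finiteP[F [TF ndF Foo]] := sigma_finiteT (@lebesgue_measure R).
have /sigma_finiteP[G [TG ndG Goo]] := sigma_finiteT mu.
exists (fun k => vsplit @^-1` (F k `*` G k)).
  rewrite -preimage_bigcup (_ : \bigcup_k _ = setT) ?preimage_setT//.
  apply/seteqP; split=> // -[x v] _.
  have : [set: measurableTypeR R] x by []. rewrite TF => -[i _ Fix].
  have : [set: 'cV[R]_n] v by []. rewrite TG => -[j _ Gjv].
  exists (maxn i j) => //; split=> /=.
  - by move: x Fix; exact/subsetPset/ndF/leq_maxl.
  - by move: v Gjv; exact/subsetPset/ndG/leq_maxr.
move=> k; have [mF Fk] := Foo k; have [mG Gk] := Goo k; split.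
  rewrite -[X in measurable X]setTI; apply: measurable_vsplit => //.
  exact: measurableX.
rewrite /lebesgue_measure_cons /pushforward -comp_preimage.
rewrite (_ : vsplit \o vcons = id); last by apply/funext => p /=; rewrite vconsK.
by rewrite preimage_id product_measure1E// lte_mul_pinfty// ge0_fin_numE.
Qed.

HB.instance Definition _ := Measure_isSigmaFinite.Build _ _ _
  lebesgue_measure_cons lebesgue_measure_cons_sigma_finite.

End lebesgue_measure_cons.

Section lebesgue_measure_cV.
Local Open Scope ereal_scope.
Context {R : realType}.

(* Lebesgue measure on R^n, as the n-fold product of the Lebesgue measure of the
   line (a point mass when n = 0); see [lebesgue_measure_cV_box]. *)
Fixpoint lebesgue_measure_cV n :
    {sigma_finite_measure set 'cV[R]_n -> \bar R} :=
  if n is n'.+1 then lebesgue_measure_cons (lebesgue_measure_cV n')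
  else \d_ (0%R : 'cV[R]_0).

Lemma lebesgue_measure_cV_box n (B : 'I_n -> set (measurableTypeR R)) :
  (forall i, measurable (B i)) ->
  lebesgue_measure_cV n [set v | forall i, B i (v i ord0)] =
  \prod_(i < n) lebesgue_measure (B i).
Proof.
elim: n B => [|n IHn] B mB /=.
  by rewrite big_ord0 diracE mem_set// => -[].
rewrite big_ord_recl -IHn// -product_measure1E//; last first.
  rewrite (_ : (fun x => _) = \bigcap_(i in [set: 'I_n])
      (fun v : 'cV[R]_n => v i ord0) @^-1` B (lift ord0 i)).
    apply: fin_bigcap_measurable => [|i _]; first exact: finite_finset.
    rewrite -[X in measurable X]setTI; apply: measurable_entry => //; exact: mB.
  by apply/seteqP; split=> v vB i; [move=> _|]; exact: vB.
rewrite /lebesgue_measure_cons /pushforward; congr (_ _).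
apply/seteqP; split=> -[x v] /= => [vB|[xB vB] i].
- split; first by have := vB ord0; rewrite vcons0.
  by move=> i; have := vB (lift ord0 i); rewrite vconsS.
- by have [j ->|->] := unliftP ord0 i; rewrite ?vconsS ?vcons0.
Qed.

End lebesgue_measure_cV.

Section complex_integration.
Context {R : realType} d (T : measurableType d).
Implicit Type f : T -> R[i].

Definition cmeasurable f :=
  measurable_fun [set: T] (fun x => complex.Re (f x)) /\
  measurable_fun [set: T] (fun x => complex.Im (f x)).

Definition cintegrable (mu : {measure set T -> \bar R}) f :=
  mu.-integrable [set: T] (fun x => (complex.Re (f x))%:E) /\
  mu.-integrable [set: T] (fun x => (complex.Im (f x))%:E).

Definition cintegral (mu : {measure set T -> \bar R}) f : R[i] :=
  (\int[mu]_x complex.Re (f x)) +i* (\int[mu]_x complex.Im (f x)).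

End complex_integration.

Section wigner.
Context {R : realType}.

Definition cexp (z : R[i]) : R[i] :=
  (expR (complex.Re z))%:C * (cos (complex.Im z) +i* sin (complex.Im z)).

(* The Euclidean norm: the norm [`|v|] of the library is the sup norm. *)
Definition dotv n (u v : 'cV[R]_n) : R := \sum_(i < n) u i 0 * v i 0.
Definition sqnormv n (v : 'cV[R]_n) : R := dotv v v.

Definition L2norm n (f : 'cV[R]_n -> R[i]) : \bar R :=
  ('N[lebesgue_measure_cV n]_2%:E[EFin \o (fun x => Normc.normc (f x))])%E.

(* Functions rather than almost-everywhere classes; every class of L^2(R^n) has
   such a Borel representative, and [wigner] does not depend on its choice. *)
Definition inL2 n (f : 'cV[R]_n -> R[i]) : Prop :=
  cmeasurable f /\ (L2norm f < +oo)%E.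

Definition sympJ n : 'M[R]_(n + n) := block_mx 0 1%:M (- 1%:M) 0.

Definition symplectic n (S : 'M[R]_(n + n)) : Prop :=
  S^T *m sympJ n *m S = sympJ n.

Definition D12 n (S1 S2 : 'M[R]_(n + n)) : 'M[R]_(n + n) :=
  block_mx (ulsubmx S1) (ursubmx S1) (ulsubmx S2) (ursubmx S2).

Definition Omega n (D : 'M[R]_(n + n)) : 'M[R]_(n + n) :=
  D *m sympJ n *m D^T.

Definition wigner n (f : 'cV[R]_n -> R[i]) (z : 'cV[R]_(n + n)) : R[i] :=
  let x := usubmx z in
  let xi := dsubmx z in
  cintegral (lebesgue_measure_cV n) (fun y =>
    f (x + 2^-1 *: y) * conjc (f (x - 2^-1 *: y)) *
    cexp (- (2 * 'i%C * pi%:C * (dotv xi y)%:C))).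

(* Wigner function on R^2n with the symplectic form (z, z') |-> z . Omega^-1 z',
   Omega = D J D^T; here sqrt (det Omega) = |det D|. *)
Definition wigner_theta n (D : 'M[R]_(n + n)) (f : 'cV[R]_n -> R[i])
    (z : 'cV[R]_(n + n)) : R[i] :=
  ((Num.sqrt (\det (Omega D)))^-1)%:C * wigner f (invmx D *m z).

(* Complex entries because [wigner] is typed as a complex-valued integral; its
   values are in fact real. *)
Definition Upsilon n (D : 'M[R]_(n + n)) (f : 'cV[R]_n -> R[i]) :
    'M[R[i]]_(n + n) :=
  \matrix_(a, b) \sum_(t < n + n) \sum_(l < n + n)
    (D a t * D b l)%:C *
    cintegral (lebesgue_measure_cV (n + n))
      (fun z => (z t 0 * z l 0)%:C * wigner f z).

End wigner.

(* Main.v *)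
(* For D = D^(1,2), substitute z = D u in the integral of z_a z_b W_theta f(z).
   The Jacobian |det D| cancels the factor 1 / sqrt(det Omega), because
   det Omega = (det D)^2 det J and det J = 1; expanding (D u)_a (D u)_b then gives
   the double sum that defines Upsilon.  Each term is integrable since
   |u_t u_l| <= 1 + |u|^2.

   The substitution rule for an invertible matrix A is proved by induction on the
   dimension: when the corner entry of A is nonzero, A is the product of a
   lower unitriangular block matrix and an upper triangular block matrix, and
   Tonelli reduces each factor to a translation, to the affine rule on the line,
   or to the rule in dimension n - 1. *)

Require Import Defs.
From mathcomp Require Import all_boot all_order all_algebra.
From mathcomp Require Import all_classical all_reals all_analysis.
From mathcomp Require Import complex.
From mathcomp Require Import measurable_realfun ring lra.

Set Implicit Arguments.
Unset Strict Implicit.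
Unset Printing Implicit Defensive.

Import Order.TTheory GRing.Theory Num.Theory.
Import numFieldNormedType.Exports.

Local Open Scope classical_set_scope.
Local Open Scope ring_scope.
Local Open Scope complex_scope.

(** * Linear substitutions in Lebesgue integrals over R^n *)

Section linear_change_of_variables.
Local Open Scope ereal_scope.
Context {R : realType}.
Local Notation leb := (@lebesgue_measure R).
Local Notation vleb := (@lebesgue_measure_cV R).

Lemma measurable_affine (a b : R) :
  measurable_fun setT (fun x : measurableTypeR R => (a * x + b)%R : measurableTypeR R).
Proof. by apply: measurable_funD => //; exact: measurable_funM. Qed.

(** With [phi x = a x + b], the pushforward of Lebesgue measure by [phi], scaled by [|a|], agrees
    with Lebesgue measure on half-open intervals, so uniqueness of Lebesgue measure identifies the
    two. Integrating against a pushforward is integrating the composite. *)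
Lemma ge0_integral_affine (a b : R) (g : measurableTypeR R -> \bar R) :
  a != 0%R -> measurable_fun setT g -> (forall x, 0 <= g x) ->
  \int[leb]_x g (a * x + b)%R = (`|a|^-1)%:E * \int[leb]_x g x.
Proof.
move=> a0 mg g0; pose phi (x : measurableTypeR R) : measurableTypeR R := (a * x + b)%R.
have mphi : measurable_fun setT phi by exact: measurable_affine.
have na0 : (0 < `|a|)%R by rewrite normr_gt0.
pose k : {nonneg R} := NngNum (ltW na0).
pose mu : {measure set (measurableTypeR R) -> \bar R} :=
  mscale k (measure_function_pushforward__canonical__measure_function_Measure leb mphi).
have muE A : measurable A -> leb A = mu A.
  apply: lebesgue_measure_unique => _ [[u v] _ <-] /=.
  rewrite /mu /= /mscale /= /pushforward lebesgue_measure_itv/= lte_fin.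
  have [a_gt0|a_lt0|/esym/eqP] := ltgtP 0%R a; last by rewrite (negbTE a0).
  - rewrite (_ : phi @^-1` _ = `]((u - b) / a)%R, ((v - b) / a)%R]%classic); last first.
      apply/seteqP; split=> x /=; rewrite !in_itv/= /phi ltr_pdivrMr// ler_pdivlMr//;
      by rewrite ltrBlDr lerBrDr mulrC.
    rewrite lebesgue_measure_itv/= lte_fin ltr_pM2r ?invr_gt0// ltrD2r.
    case: ifPn; rewrite ?mule0// => _.
    rewrite -!EFinB -EFinM gtr0_norm//; congr (_%:E).
    by field.
  (* For negative [a] the map reverses order, so the preimage is closed on the left and open on the
     right; the length formula is the same. *)
  - rewrite (_ : phi @^-1` _ = `[((v - b) / a)%R, ((u - b) / a)%R[%classic); last first.
      apply/seteqP; split=> x /=; rewrite !in_itv/= /phi ltr_ndivlMr// ler_ndivrMr//;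
      by rewrite ltrBlDr lerBrDr mulrC andbC.
    rewrite lebesgue_measure_itv/= lte_fin ltr_nM2r ?invr_lt0// ltrD2r.
    case: ifPn; rewrite ?mule0// => _.
    rewrite -!EFinB -EFinM ltr0_norm//; congr (_%:E).
    by field.
have -> : \int[leb]_x g x = \int[mu]_x g x.
  by apply: eq_measure_integral => A mA _; exact: muE.
rewrite ge0_integral_mscale//= ge0_integral_pushforward// preimage_setT muleA -EFinM.
by rewrite mulVf ?normr_eq0// mul1e.
Qed.

(** Tonelli along the splitting [vcons] that defines the measure; every induction on the dimension
    below goes through it. *)
Lemma ge0_integral_cV_cons n (g : 'cV[R]_n.+1 -> \bar R) :
  measurable_fun setT g -> (forall v, 0 <= g v) ->
  \int[vleb n.+1]_v g v = \int[leb]_x \int[vleb n]_v g (vcons (x, v)).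
Proof.
move=> mg g0; rewrite [LHS](@ge0_integral_pushforward _ _ _ _ _ _ measurable_vcons)//.
rewrite preimage_setT fubini_tonelli1//; last by move=> p; exact: g0.
by apply: measurableT_comp => //; exact: measurable_vcons.
Qed.

Lemma measurable_mulmx m n (A : 'M[R]_(m, n)) :
  measurable_fun setT (fun v : 'cV[R]_n => A *m v).
Proof.
apply/measurable_fun_matrixP => i j; under eq_fun do rewrite mxE.
apply: measurable_sum => k; apply: measurable_funM => //.
exact: measurable_entry.
Qed.

Lemma measurable_addmx m n (A : 'M[R]_(m, n)) :
  measurable_fun setT (fun v : 'M[R]_(m, n) => v + A)%R.
Proof.
apply/measurable_fun_matrixP => i j; under eq_fun do rewrite mxE.
by apply: measurable_funD => //; exact: measurable_entry.
Qed.

Lemma ge0_integral_cV_shift n (w : 'cV[R]_n) (g : 'cV[R]_n -> \bar R) :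
  measurable_fun setT g -> (forall v, 0 <= g v) ->
  \int[vleb n]_v g (v + w)%R = \int[vleb n]_v g v.
Proof.
elim: n w g => [|n IHn] w g mg g0.
  by apply: eq_integral => v _; congr g; apply/matrixP => -[].
have mgw : measurable_fun setT (fun v : 'cV[R]_n.+1 => g (v + w)%R).
  exact: (measurableT_comp mg (measurable_addmx w)).
rewrite (ge0_integral_cV_cons mgw (fun v => g0 _)) (ge0_integral_cV_cons mg g0).
have [[y u] ->] : exists p, w = vcons p by exists (vsplit w); rewrite vsplitK.
(* The first coordinate is written [1 * x + y] so that the affine rule applies with slope 1. *)
have vconsD x v : (vcons (x, v) + vcons (y, u) = vcons ((1 * x + y), (v + u)))%R.
  by rewrite /vcons /= mul1r raddfD; exact: (@add_col_mx _ 1 n 1).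
under eq_integral do under eq_integral do rewrite vconsD.
have mgv : measurable_fun setT (g \o vcons).
  by apply: measurableT_comp => //; exact: measurable_vcons.
under eq_integral => x _.
  rewrite (IHn u (fun v => g (vcons (1 * x + y, v)%R)))//; last first.
    exact: (measurable_fun_pair2 _ mgv).
  over.
rewrite (ge0_integral_affine y (g := fun x => \int[vleb n]_v g (vcons (x, v))))//.
- by rewrite normr1 invr1 mul1e.
- exact: (measurable_fun_fubini_tonelli_F (m2 := vleb n) _ mgv (fun p => g0 _)).
- by move=> x; apply: integral_ge0 => v _; exact: g0.
Qed.

(** Isolating the rule as a property of [A] makes it possible to combine the factors of a matrix,
    the property being stable under products. *)
Definition scales_integral n (A : 'M[R]_n) := forall g : 'cV[R]_n -> \bar R,
  measurable_fun setT g -> (forall v, 0 <= g v) ->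
  \int[vleb n]_v g (A *m v) = (`|\det A|^-1)%:E * \int[vleb n]_v g v.

Lemma scales_integral_mulmx n (A B : 'M[R]_n) :
  scales_integral A -> scales_integral B -> scales_integral (A *m B).
Proof.
move=> hA hB g mg g0; under eq_integral do rewrite -mulmxA.
rewrite (hB (fun v : 'cV[R]_n => g (A *m v)))//; last first.
  exact: (measurableT_comp mg (measurable_mulmx A)).
by rewrite hA// muleA -EFinM det_mulmx normrM invfM mulrC.
Qed.

(** For a fixed first coordinate [x], the matrix only translates the remaining coordinates by
    [x *: c]. *)
Lemma scales_integral_lower n (c : 'cV[R]_n) :
  scales_integral ((block_mx 1%:M 0 c 1%:M)%R : 'M[R]_n.+1).
Proof.
move=> g mg g0; set L := block_mx _ _ _ _.
have -> : \det (L : 'M[R]_n.+1) = 1%R by rewrite [LHS](@det_lblock _ 1 n) !det1 mulr1.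
rewrite normr1 invr1 mul1e.
have mgL : measurable_fun setT (fun v : 'cV[R]_n.+1 => g (L *m v)).
  exact: (measurableT_comp mg (measurable_mulmx L)).
rewrite (ge0_integral_cV_cons mgL (fun v => g0 _)) (ge0_integral_cV_cons mg g0); apply: eq_integral => x _.
under eq_integral => v _.
  rewrite (_ : L *m _ = vcons (x, v + x *: c)%R); last first.
    rewrite /vcons /L [LHS]mul_block_col /= !mul1mx mul0mx addr0.
    by rewrite mul_mx_scalar addrC.
  over.
rewrite (ge0_integral_cV_shift (x *: c) (g := fun v => g (vcons (x, v))))//.
have mgv : measurable_fun setT (g \o vcons).
  by apply: measurableT_comp => //; exact: measurable_vcons.
exact: (measurable_fun_pair2 _ mgv).
Qed.

(** The matrix sends [(x, v)] to [(a x + r v, M v)]: the integral over [x] contributes [|a|^-1], and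
    the rule for [M] handles what is left. *)
Lemma scales_integral_upper n (a : R) (r : 'rV[R]_n) (M : 'M[R]_n) : a != 0%R ->
  scales_integral M -> scales_integral ((block_mx a%:M r 0 M)%R : 'M[R]_n.+1).
Proof.
move=> a0 hM g mg g0.
have mgv : measurable_fun setT (g \o vcons).
  by apply: measurableT_comp => //; exact: measurable_vcons.
set U := block_mx _ _ _ _.
have -> : \det (U : 'M[R]_n.+1) = (a * \det M)%R by rewrite [LHS](@det_ublock _ 1 n) det_scalar1.
have mgU : measurable_fun setT (fun v : 'cV[R]_n.+1 => g (U *m v)).
  exact: (measurableT_comp mg (measurable_mulmx U)).
have UE x v : U *m vcons (x, v) = vcons (a * x + (r *m v) 0 0, M *m v)%R.
  rewrite /vcons /U [LHS]mul_block_col /= mul0mx add0r -scalar_mxM.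
  by rewrite [in LHS](mx11_scalar (r *m v)) -raddfD.
rewrite (ge0_integral_cV_cons mgU (fun v => g0 _)) (ge0_integral_cV_cons mg g0).
under eq_integral do under eq_integral do rewrite UE.
(* The offset [r v] is a constant only once [v] is fixed, so [x] must become the inner variable; the
   last line of the proof swaps back. *)
rewrite (fubini_tonelli (m1 := leb) (m2 := vleb n)
  (fun p : measurableTypeR R * 'cV[R]_n => g (vcons (a * p.1 + (r *m p.2) 0 0, M *m p.2)%R)))//; last first.
  apply: (eq_measurable_fun (fun p : measurableTypeR R * 'cV[R]_n => g (U *m vcons p))).
    by move=> [x v] _; rewrite UE.
  exact: (measurableT_comp mgU measurable_vcons).
under eq_integral => v _.
  rewrite (ge0_integral_affine ((r *m v) 0%R 0%R)
    (g := fun x => g (vcons (x, M *m v))))//; last first.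
    exact: (measurable_fun_pair1 _ mgv).
  over.
have mG : measurable_fun setT (fun v : 'cV[R]_n => \int[leb]_x g (vcons (x, v))).
  exact: (measurable_fun_fubini_tonelli_G (m1 := leb) _ mgv (fun p => g0 _)).
have G0 v : 0 <= \int[leb]_x g (vcons (x, v)) by apply: integral_ge0 => x _; exact: g0.
rewrite ge0_integralZl//; last 1 first.
- exact: (measurableT_comp mG (measurable_mulmx M)).
rewrite (hM (fun v : 'cV[R]_n => \int[leb]_x g (vcons (x, v))))//.
rewrite muleA -EFinM -invfM -normrM.
by rewrite -(fubini_tonelli (m1 := leb) (m2 := vleb n) _ mgv (fun p => g0 _)).
Qed.

Lemma scales_integral1 n : scales_integral (1%:M%R : 'M[R]_n).
Proof.
by move=> g _ _; rewrite det1 normr1 invr1 mul1e; under eq_integral do rewrite mul1mx.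
Qed.

Lemma ge0_integral_mulmx n (A : 'M[R]_n) : \det A != 0%R -> scales_integral A.
Proof.
elim: n A => [|n IHn] A detA.
  have -> : A = 1%:M%R by apply/matrixP => -[].
  exact: scales_integral1.
have corner0 (B : 'M[R]_(1 + n)) :
    \det B != 0%R -> ulsubmx B 0%R 0%R != 0%R -> scales_integral B.
  rewrite -[B]submxK block_mxKul.
  move: (ulsubmx B) (ursubmx B) (dlsubmx B) (drsubmx B) => a r c M.
  rewrite [a]mx11_scalar; move: (a 0%R 0%R) => {}a; rewrite mxE mulr1n => detB a0.
  (* Block LU factorisation. The lower right block of the second factor is the Schur complement of
     [a]; its determinant times [a] is the determinant of the whole matrix, so the induction
     hypothesis applies to it. *)
  have BE : (block_mx a%:M r c M = block_mx 1%:M 0 (a^-1 *: c) 1%:M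
      *m block_mx a%:M r 0 (M - a^-1 *: c *m r))%R.
    rewrite mulmx_block !mul1mx !mul0mx !addr0.
    by rewrite mul_mx_scalar scalerA divff// scale1r addrC subrK.
  rewrite BE; apply: scales_integral_mulmx; first exact: scales_integral_lower.
  apply: scales_integral_upper => //; apply: IHn.
  move: detB; rewrite BE det_mulmx det_lblock !det1 !mul1r det_ublock.
  by rewrite mulf_eq0 negb_or => /andP[].
have ulE (B : 'M[R]_(1 + n)) : ulsubmx B 0%R 0%R = B ord0 ord0.
  by rewrite !mxE; congr (B _ _); exact/val_inj.
have [A00|] := eqVneq (A ord0 ord0) 0%R; last first.
  by rewrite -(ulE A); exact: corner0.
have [i Ai0] : exists i, A i ord0 != 0%R.
  apply/existsP; apply: contraNT detA; rewrite negb_exists => /forallP A0.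
  rewrite (expand_det_col _ ord0) big1// => i _.
  by have /negPn/eqP -> := A0 i; rewrite mul0r.
(* Adding row i to row 0 makes the corner entry nonzero. *)
have [j ij|i0] := unliftP ord0 i; last by rewrite i0 A00 eqxx in Ai0.
pose U (s : R) : 'M[R]_(1 + n) := (block_mx 1%:M (s *: delta_mx 0 j) 0 1%:M)%R.
(* [U (-1)] inverts [U 1], and it is itself upper triangular with unit diagonal. *)
have UK : A = U (-1)%R *m (U 1%R *m A).
  rewrite mulmxA /U [X in X *m A]mulmx_block !mul1mx !mul0mx !mulmx0 !mulmx1 !addr0 add0r.
  by rewrite scaleN1r scale1r subrr -scalar_mx_block mul1mx.
have detU1 : \det (U 1%R) = 1%R by rewrite det_ublock !det1 mulr1.
rewrite UK; apply: scales_integral_mulmx.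
  apply: scales_integral_upper; first exact: oner_neq0.
  exact: scales_integral1.
apply: (corner0 (U 1%R *m A)); first by rewrite det_mulmx detU1 mul1r.
have -> : U 1%R *m A = col_mx (usubmx (A : 'M[R]_(1 + n, n.+1)) + row j (dsubmx (A : 'M[R]_(1 + n, n.+1))))%R
                        (dsubmx (A : 'M[R]_(1 + n, n.+1))).
  rewrite -[in LHS](@vsubmxK _ 1 n n.+1 A) [LHS]mul_block_col.
  by rewrite !mul1mx mul0mx add0r scale1r -rowE.
rewrite /ulsubmx col_mxKu !mxE.
rewrite (_ : lshift n 0%R = ord0 :> 'I_(1 + n)); last exact/val_inj.
rewrite (_ : rshift 1 j = i :> 'I_(1 + n)); last by rewrite ij; exact/val_inj.
by rewrite A00 add0r.
Qed.

Lemma integrable_mulmx n (A : 'M[R]_n) (g : 'cV[R]_n -> \bar R) :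
  \det A != 0%R -> (vleb n).-integrable setT g ->
  (vleb n).-integrable setT (fun v => g (A *m v)).
Proof.
move=> detA /integrableP[mg gfin]; apply/integrableP; split.
  exact: (measurableT_comp mg (measurable_mulmx A)).
rewrite (ge0_integral_mulmx detA (g := fun v : 'cV[R]_n => `|g v|)) //.
  by rewrite lte_mul_pinfty.
exact: measurableT_comp.
Qed.

(** The nonnegative rule is applied to the positive and negative parts; integrability of [g] lets
    the scalar distribute over their difference. *)
Lemma integral_mulmx n (A : 'M[R]_n) (g : 'cV[R]_n -> \bar R) :
  \det A != 0%R -> (vleb n).-integrable setT g ->
  \int[vleb n]_v g (A *m v) = (`|\det A|^-1)%:E * \int[vleb n]_v g v.
Proof.
move=> detA ig; have mg := measurable_int _ ig.
rewrite integralE [in RHS]integralE muleBr//; last exact: integrable_add_def.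
congr (_ - _).
- rewrite -(ge0_integral_mulmx detA (measurable_funepos mg) (fun v => funepos_ge0 g v)).
  by apply: eq_integral => v _; rewrite !funeposE.
- rewrite -(ge0_integral_mulmx detA (measurable_funeneg mg) (fun v => funeneg_ge0 g v)).
  by apply: eq_integral => v _; rewrite !funenegE.
Qed.

(** The integrals of the positive and negative parts of a section depend measurably on [x] by
    Tonelli, hence so does their difference, and [fine] is measurable. *)
Lemma measurable_Rintegral d1 d2 (T1 : measurableType d1) (T2 : measurableType d2)
    (m2 : {sigma_finite_measure set T2 -> \bar R}) (h : T1 * T2 -> R) :
  measurable_fun setT h -> measurable_fun setT (fun x => \int[m2]_y h (x, y))%R.
Proof.
move=> mh.
have mh' : measurable_fun setT (EFin \o h) by exact/measurable_EFinP.
have m1 : measurable_fun setT (fun x => \int[m2]_y (EFin (h (x, y)))).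
  rewrite (_ : (fun x => _) =
      fubini_F m2 (EFin \o h)^\+ \- fubini_F m2 (EFin \o h)^\-); last first.
    apply/funext => x; rewrite integralE /fubini_F.
    by congr (_ - _); apply: eq_integral => y _; rewrite ?funeposE ?funenegE.
  apply: emeasurable_funB.
  - by apply: measurable_fun_fubini_tonelli_F => //; exact: measurable_funepos.
  - by apply: measurable_fun_fubini_tonelli_F => //; exact: measurable_funeneg.
by apply: (measurableT_comp _ m1); exact: fine_measurable.
Qed.

End linear_change_of_variables.

(** * Measurability of complex-valued functions *)

Section complex_measurability.
Context {R : realType}.

Lemma Re_mulc (x y : R[i]) : complex.Re (x * y) =
  complex.Re x * complex.Re y - complex.Im x * complex.Im y.
Proof. by case: x; case: y. Qed.

Lemma Im_mulc (x y : R[i]) : complex.Im (x * y) =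
  complex.Re x * complex.Im y + complex.Im x * complex.Re y.
Proof. by case: x; case: y. Qed.

(** This bound and the next one carry the moment condition on the modulus of the Wigner function
    over to its real and imaginary parts. *)
Lemma normr_Re_le_normc (x : R[i]) : `|complex.Re x| <= Normc.normc x.
Proof. by case: x => a b /=; rewrite -sqrtr_sqr ler_wsqrtr// lerDl sqr_ge0. Qed.

Lemma normr_Im_le_normc (x : R[i]) : `|complex.Im x| <= Normc.normc x.
Proof. by case: x => a b /=; rewrite -sqrtr_sqr ler_wsqrtr// lerDr sqr_ge0. Qed.

Context d (T : measurableType d).
Implicit Type f g : T -> R[i].

Lemma cmeasurableM f g : cmeasurable f -> cmeasurable g ->
  cmeasurable (fun x => f x * g x).
Proof.
move=> [mfr mfi] [mgr mgi]; split.
- by under eq_fun do rewrite Re_mulc; apply: measurable_funB; exact: measurable_funM.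
- by under eq_fun do rewrite Im_mulc; apply: measurable_funD; exact: measurable_funM.
Qed.

Lemma cmeasurable_real (h : T -> R) :
  measurable_fun setT h -> cmeasurable (fun x => (h x)%:C).
Proof. by split. Qed.

Lemma cmeasurable_conjc f : cmeasurable f -> cmeasurable (fun x => conjc (f x)).
Proof.
move=> [mfr mfi]; split.
- by rewrite (_ : (fun x => _) = (fun x => complex.Re (f x)))//; apply/funext => x; case: (f x).
- rewrite (_ : (fun x => _) = (fun x => - complex.Im (f x))).
    exact: measurable_funN.
  by apply/funext => x; case: (f x).
Qed.

Lemma cmeasurable_cexp f : cmeasurable f -> cmeasurable (fun x => cexp (f x)).
Proof.
move=> [mfr mfi]; apply: cmeasurableM.
  by apply: cmeasurable_real; exact: measurableT_comp.
split=> /=.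
- by apply: (measurableT_comp _ mfi); exact: continuous_measurable_fun (@continuous_cos R).
- by apply: (measurableT_comp _ mfi); exact: continuous_measurable_fun (@continuous_sin R).
Qed.

Lemma measurable_normc f : cmeasurable f ->
  measurable_fun setT (fun x => Normc.normc (f x)).
Proof.
move=> [mfr mfi].
rewrite (_ : (fun x => _) = (fun x =>
  Num.sqrt (complex.Re (f x) ^+ 2 + complex.Im (f x) ^+ 2))); last first.
  by apply/funext => x; case: (f x).
apply: (measurableT_comp (f := @Num.sqrt R)).
  exact: continuous_measurable_fun (@sqrt_continuous R).
by apply: measurable_funD; exact: measurable_funX.
Qed.

End complex_measurability.

Lemma cmeasurable_comp (R : realType) d1 d2 (T1 : measurableType d1)
    (T2 : measurableType d2) (f : T2 -> R[i]) (phi : T1 -> T2) :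
  cmeasurable f -> measurable_fun setT phi -> cmeasurable (fun x => f (phi x)).
Proof.
by move=> [mfr mfi] mphi; split;
  [exact: (measurableT_comp mfr mphi)|exact: (measurableT_comp mfi mphi)].
Qed.

(** * Measurability of the Wigner function *)

Section wigner_measurability.
Context {R : realType} {n : nat}.
Local Notation vleb := (@lebesgue_measure_cV R).

(** The integrand [F] is jointly measurable in [(z, y)], so [measurable_Rintegral] applies to its
    real and imaginary parts. *)
Lemma cmeasurable_wigner (f : 'cV[R]_n -> R[i]) :
  cmeasurable f -> cmeasurable (wigner f).
Proof.
move=> mf.
pose F (p : 'cV[R]_(n + n) * 'cV[R]_n) : R[i] :=
  f (usubmx p.1 + 2^-1 *: p.2) * conjc (f (usubmx p.1 - 2^-1 *: p.2)) *
    cexp (- (2 * 'i%C * pi%:C * (dotv (dsubmx p.1) p.2)%:C)).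
have mz i : measurable_fun setT (fun p : 'cV[R]_(n + n) * 'cV[R]_n => p.1 i 0).
  exact: (measurableT_comp (measurable_entry i 0) measurable_fst).
have my i : measurable_fun setT (fun p : 'cV[R]_(n + n) * 'cV[R]_n => p.2 i 0).
  exact: (measurableT_comp (measurable_entry i 0) measurable_snd).
have mshift (s : R) : measurable_fun setT
    (fun p : 'cV[R]_(n + n) * 'cV[R]_n => usubmx p.1 + s *: p.2).
  apply/measurable_fun_matrixP => i j; rewrite ord1.
  under eq_fun do rewrite !mxE.
  by apply: measurable_funD => //; apply: measurable_funM.
have mF : cmeasurable F.
  apply: cmeasurableM.
    apply: cmeasurableM.
      exact: cmeasurable_comp.
    apply: cmeasurable_conjc; apply: cmeasurable_comp => //.
    by under eq_fun do rewrite -scaleNr; exact: mshift.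
  apply: cmeasurable_cexp.
  (* Moving the sign inward presents the exponent as a complex constant times a real function. *)
  under eq_fun do rewrite -mulNr.
  apply: cmeasurableM; first by split; exact: measurable_cst.
  apply: cmeasurable_real; apply: measurable_sum => i; apply: measurable_funM => //.
  by under eq_fun do rewrite mxE; exact: mz.
by case: mF => mRe mIm; split;
  [exact: (measurable_Rintegral (vleb n) mRe)
  |exact: (measurable_Rintegral (vleb n) mIm)].
Qed.

End wigner_measurability.

(** * Second moments under the substitution z = D u *)

Section second_moments.
Context {R : realType}.
Local Notation vleb := (@lebesgue_measure_cV R).

Lemma sqrt_det_Omega n (D : 'M[R]_(n + n)) :
  Num.sqrt (\det (Omega D)) = `|\det D|.
Proof.
have detJ : \det (sympJ n : 'M[R]_(n + n)) = 1.
  (* [sympJ n] is a product of three unitriangular block matrices, so its determinant is 1. *)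
  have -> : sympJ n = block_mx 1%:M 1%:M 0 1%:M *m block_mx 1%:M 0 (- 1%:M) 1%:M
      *m block_mx 1%:M 1%:M 0 1%:M :> 'M[R]_(n + n).
    rewrite !mulmx_block !(mul1mx, mulmx1, mul0mx, mulmx0, addr0, add0r).
    by rewrite subrr add0r addNr.
  by rewrite !det_mulmx !det_ublock det_lblock !det1 !mulr1.
by rewrite /Omega !det_mulmx det_tr detJ mulr1 -expr2 sqrtr_sqr.
Qed.

Lemma normr_entryM_le_sqnormv n (v : 'cV[R]_n) i j :
  `|v i 0 * v j 0| <= 1 + sqnormv v.
Proof.
have sqr_entry k : v k 0 ^+ 2 <= sqnormv v.
  rewrite /sqnormv /dotv (bigD1 k)//= -expr2 lerDl sumr_ge0// => l _.
  by rewrite -expr2 sqr_ge0.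
(* From [(v_i + v_j)^2 >= 0] and [(v_i - v_j)^2 >= 0] follows [2 |v_i v_j| <= v_i^2 + v_j^2], which
   is at most twice [sqnormv v]. *)
have := sqr_entry i; have := sqr_entry j.
rewrite ler_norml; have := sqr_ge0 (v i 0 + v j 0); have := sqr_ge0 (v i 0 - v j 0).
move=> *; apply/andP; split; nra.
Qed.

(** Here [w] stands for the real or the imaginary part of the Wigner function. *)
Lemma second_moment_mulmx n (D : 'M[R]_n) (w : 'cV[R]_n -> R) (a b : 'I_n) :
  \det D != 0 ->
  (forall t l, (vleb n).-integrable setT (fun z => (z t 0 * z l 0 * w z)%:E)) ->
  (vleb n).-integrable setT
    (fun z => (z a 0 * z b 0 * (`|\det D|^-1 * w (invmx D *m z)))%:E) /\
  \int[vleb n]_z (z a 0 * z b 0 * (`|\det D|^-1 * w (invmx D *m z))) =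
  \sum_t \sum_l D a t * D b l * \int[vleb n]_z (z t 0 * z l 0 * w z).
Proof.
move=> detD iw; have uD : D \in unitmx by rewrite unitmxE unitfE.
have detDV : \det (invmx D) != 0 by rewrite det_inv invr_eq0.
(* This is [|det D|^-1 (D u)_a (D u)_b w(u)] expanded, so that integrability and the integral can be
   treated term by term. *)
pose g (u : 'cV[R]_n) : \bar R :=
  (\sum_t \sum_l (`|\det D|^-1 * (D a t * D b l))%:E * (u t 0 * u l 0 * w u)%:E)%E.
have ig1 t l : (vleb n).-integrable setT (fun u : 'cV[R]_n =>
    (`|\det D|^-1 * (D a t * D b l))%:E * (u t 0 * u l 0 * w u)%:E)%E.
  exact: integrableZl.
have ig : (vleb n).-integrable setT g.
  by apply: integrable_sum => // t _; apply: integrable_sum.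
have gE (z : 'cV[R]_n) : (z a 0 * z b 0 * (`|\det D|^-1 * w (invmx D *m z)))%:E =
    g (invmx D *m z).
  rewrite /g; under eq_bigr do (under eq_bigr do rewrite -EFinM; rewrite sumEFin).
  rewrite sumEFin; congr EFin.
  (* Only the [z] in the two coordinate factors becomes [D u]; the argument of [w] is already
     [u]. *)
  rewrite -{1 2}(mulKVmx uD z); set u := invmx D *m z.
  rewrite !mxE mulr_suml mulr_suml; apply: eq_bigr => t _.
  rewrite mulr_sumr mulr_suml; apply: eq_bigr => l _; ring.
split.
  under eq_fun do rewrite gE; exact: integrable_mulmx.
rewrite /Rintegral; under eq_integral do rewrite gE.
(* The rule is used for the inverse of [D], so its factor is [|det D|], which cancels the
   [|det D|^-1] in [g]. *)
rewrite integral_mulmx// det_inv normfV invrK integral_sum//; last first.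
  by move=> t; exact: integrable_sum.
have -> : (\sum_t (\int[vleb n]_u (\sum_l ((`|\det D|^-1 * (D a t * D b l))%:E *
    (u t 0 * u l 0 * w u)%:E)%E)%R))%E =
  (\sum_t \sum_l `|\det D|^-1 * (D a t * D b l) * \int[vleb n]_u (u t 0 * u l 0 * w u))%:E.
  rewrite -sumEFin; apply: eq_bigr => t _; rewrite integral_sum// -sumEFin.
  apply: eq_bigr => l _; rewrite integralZl// [in RHS]EFinM /Rintegral fineK//.
  exact: integrable_fin_num.
rewrite -EFinM /= mulr_sumr; apply: eq_bigr => t _.
rewrite mulr_sumr; apply: eq_bigr => l _.
by rewrite !mulrA divff ?normr_eq0// mul1r.
Qed.

(** Domination by [(1 + |z|^2) |W z|], with [w] meant to be the real or imaginary part of [W]. *)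
Lemma integrable_second_moment n (W : 'cV[R]_n -> R[i]) (w : 'cV[R]_n -> R) t l :
  cmeasurable W -> measurable_fun setT w ->
  (forall z, `|w z| <= Normc.normc (W z)) ->
  (\int[vleb n]_z ((1 + sqnormv z) * Normc.normc (W z))%:E < +oo)%E ->
  (vleb n).-integrable setT (fun z => (z t 0 * z l 0 * w z)%:E).
Proof.
move=> mW mw w_le W_fin.
have me (i : 'I_n) : measurable_fun setT (fun z : 'cV[R]_n => z i 0).
  exact: measurable_entry.
have sq_ge0 (z : 'cV[R]_n) : 0 <= sqnormv z.
  by apply: sumr_ge0 => i _; rewrite -expr2 sqr_ge0.
have n_ge0 z : 0 <= Normc.normc (W z) by exact: le_trans (w_le z).
apply: (@le_integrable _ _ _ _ _ _ _
    (fun z => ((1 + sqnormv z) * Normc.normc (W z))%:E)) => //.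
- by apply/measurable_EFinP; do 2 apply: measurable_funM => //.
- move=> z _; rewrite /= lee_fin [leRHS]ger0_norm ?mulr_ge0 ?addr_ge0//.
  by rewrite normrM ler_pM// normr_entryM_le_sqnormv.
apply/integrableP; split.
  apply/measurable_EFinP; apply: measurable_funM; last exact: measurable_normc.
  apply: measurable_funD => //; apply: measurable_sum => i.
  exact: measurable_funM.
under eq_integral do rewrite gee0_abs ?lee_fin ?mulr_ge0 ?addr_ge0//.
by [].
Qed.

End second_moments.

(** * Real and imaginary parts of sums and real multiples, and the covariance identity *)

Lemma Re_sum (R : realType) (I : finType) (F : I -> R[i]) :
  complex.Re (\sum_i F i) = \sum_i complex.Re (F i).
Proof.
have ReD : {morph @complex.Re R : x y / x + y} by move=> [? ?] [? ?].
exact: (big_morph _ ReD).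
Qed.

Lemma Im_sum (R : realType) (I : finType) (F : I -> R[i]) :
  complex.Im (\sum_i F i) = \sum_i complex.Im (F i).
Proof.
have ImD : {morph @complex.Im R : x y / x + y} by move=> [? ?] [? ?].
exact: (big_morph _ ImD).
Qed.

Lemma Re_realM (R : realType) (r : R) (x : R[i]) :
  complex.Re (r%:C * x) = r * complex.Re x.
Proof. by rewrite Re_mulc /= mul0r subr0. Qed.

Lemma Im_realM (R : realType) (r : R) (x : R[i]) :
  complex.Im (r%:C * x) = r * complex.Im x.
Proof. by rewrite Im_mulc /= mul0r addr0. Qed.

Theorem lemma11 (R : realType) (n : nat) (S1 S2 : 'M[R]_(n + n))
    (f : 'cV[R]_n -> R[i])
    (hS1 : symplectic S1) (hS2 : symplectic S2)
    (hD : \det (D12 S1 S2) != 0)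
    (hf : inL2 f) (hf1 : L2norm f = 1%E)
    (hW : (\int[lebesgue_measure_cV (n + n)]_z
             ((1 + sqnormv z) * Normc.normc (wigner f z))%:E < +oo)%E)
    (hmean : forall a : 'I_(n + n),
       cintegral (lebesgue_measure_cV (n + n))
         (fun z => (z a 0)%:C * wigner f z) = 0)
    (a b : 'I_(n + n)) :
  cintegrable (lebesgue_measure_cV (n + n))
    (fun z => (z a 0 * z b 0)%:C * wigner_theta (D12 S1 S2) f z) /\
  Upsilon (D12 S1 S2) f a b =
  cintegral (lebesgue_measure_cV (n + n))
    (fun z => (z a 0 * z b 0)%:C * wigner_theta (D12 S1 S2) f z).
Proof.
set D := D12 S1 S2 in hD *.
have mW : cmeasurable (wigner f) by apply: cmeasurable_wigner; case: hf.
have [mRe mIm] := mW.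
have [iRe ERe] := second_moment_mulmx a b hD (fun t l =>
  integrable_second_moment t l mW mRe (fun z => normr_Re_le_normc _) hW).
have [iIm EIm] := second_moment_mulmx a b hD (fun t l =>
  integrable_second_moment t l mW mIm (fun z => normr_Im_le_normc _) hW).
have ReE (z : 'cV[R]_(n + n)) : complex.Re ((z a 0 * z b 0)%:C * wigner_theta D f z) =
    z a 0 * z b 0 * (`|\det D|^-1 * complex.Re (wigner f (invmx D *m z))).
  by rewrite !Re_realM sqrt_det_Omega.
have ImE (z : 'cV[R]_(n + n)) : complex.Im ((z a 0 * z b 0)%:C * wigner_theta D f z) =
    z a 0 * z b 0 * (`|\det D|^-1 * complex.Im (wigner f (invmx D *m z))).
  by rewrite !Im_realM sqrt_det_Omega.
(* Integrability ensures that the integral in the second conjunct is a genuine one and not a default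
   value. *)
split.
  by split; [under eq_fun do rewrite ReE|under eq_fun do rewrite ImE].
rewrite /cintegral (eq_Rintegral _ (fun z _ => ReE z)).
rewrite (eq_Rintegral _ (fun z _ => ImE z)) ERe EIm mxE.
(* The entries of [D] and the coordinates of [z] are real, so the real and imaginary parts separate
   and match term by term. *)
apply/eqP; rewrite eq_complex Re_sum Im_sum; apply/andP; split; apply/eqP.
- apply: eq_bigr => t _; rewrite Re_sum; apply: eq_bigr => l _.
  rewrite Re_realM; congr (_ * _).
  by apply: eq_Rintegral => z _; exact: Re_realM.
- apply: eq_bigr => t _; rewrite Im_sum; apply: eq_bigr => l _.
  rewrite Im_realM; congr (_ * _).
  by apply: eq_Rintegral => z _; exact: Im_realM.
Qed.
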